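(* Let $p$ be a prime, let $T_p$ be a finite abelian $p$-group and let $\psi_p\colon T_p\to\mathbb{Q}/\mathbb{Z}$ be a quadratic $2$-linear function. (1) If $p\equiv1\bmod 4$, then $\psi_p\cong-\psi_p$. (2) If $p\equiv3\bmod4$, then $\psi_p\perp\psi_p\cong(-\psi_p)\perp(-\psi_p)$. (3) If $p=2$, then $\psi_2\perp\psi_2\perp\psi_2\perp\psi_2\cong(-\psi_2)\perp(-\psi_2)\perp(-\psi_2)\perp(-\psi_2)$.
   Context: A function $\psi\colon T\to\mathbb{Q}/\mathbb{Z}$ on a finite abelian group is $2$-linear if $\psi(x+y)-\psi(x)-\psi(y)$ is bilinear in $(x,y)$, and it is quadratic if moreover $\psi(ax)=a^2\psi(x)$ for all $a\in\mathbb{Z}$, $x\in T$. The orthogonal sum of $\psi_1$ on $T_1$ and $\psi_2$ on $T_2$ is the function $(\psi_1\perp\psi_2)(x_1,x_2)=\psi_1(x_1)+\psi_2(x_2)$ on $T_1\oplus T_2$. $(-\psi)(x)=-\psi(x)$. Two functions $\psi_1$ on $T_1$ and $\psi_2$ on $T_2$ are isometric, $\psi_1\cong\psi_2$, if there is a group isomorphism $h\colon T_1\to T_2$ with $\psi_2(h(x))=\psi_1(x)$ for all $x\in T_1$. *)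

(* Defs.v *)
From HB Require Import structures.
From mathcomp Require Import all_boot all_order all_fingroup all_algebra all_solvable.

Set Implicit Arguments.
Unset Strict Implicit.
Unset Printing Implicit Defensive.

Import GRing.Theory.
Local Open Scope ring_scope.

(* Num.int is the predicate of integers in rat; int_num_subdef is the constant
   behind it that carries the zmodClosed structure. *)
Definition QmodZ : Type := {ideal_quot (Num.int_num_subdef : {pred rat})}.
HB.instance Definition _ := ZmodQuotient.on QmodZ.

(* Over the integers, additivity in each argument already gives compatibility
   with scalars. *)
Definition bilinear_map (U V W : zmodType) (b : U -> V -> W) : Prop :=
  (forall v, zmod_morphism (b^~ v)) /\ (forall u, zmod_morphism (b u)).

Definition two_linear (T : zmodType) (psi : T -> QmodZ) : Prop :=
  bilinear_map (fun x y : T => psi (x + y) - psi x - psi y).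

Definition quadratic (T : zmodType) (psi : T -> QmodZ) : Prop :=
  two_linear psi /\
  forall (a : int) (x : T), psi (x *~ a) = psi x *~ (a ^+ 2).

Definition orthogonal_sum (T1 T2 : zmodType)
    (psi1 : T1 -> QmodZ) (psi2 : T2 -> QmodZ) : (T1 * T2)%type -> QmodZ :=
  fun x => psi1 x.1 + psi2 x.2.

Notation "f \perp g" := (orthogonal_sum f g)
  (at level 50, left associativity) : ring_scope.

Definition isometric (T1 T2 : zmodType)
    (psi1 : T1 -> QmodZ) (psi2 : T2 -> QmodZ) : Prop :=
  exists h : {additive T1 -> T2},
    bijective h /\ forall x, psi2 (h x) = psi1 x.

Notation "f \cong g" := (isometric f g)
  (at level 70, no associativity) : ring_scope.

(* Main.v *)
(* If an integer matrix M satisfies M^T M = -1 modulo #|T|^2, then M acting on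
   a power of T is an isometry from the corresponding orthogonal power of psi
   to that of - psi, because psi x has order dividing #|T|^2.  Such a matrix is
   a square root of -1 (p = 1 mod 4), a Gaussian integer of norm -1
   (p = 3 mod 4), or a quaternion of norm -1 (p = 2), the congruences being
   solved modulo p by counting, and modulo 8 by -7 = 1, then lifted by Hensel's
   method.  The quaternion matrix is built from Gaussian integers acting on
   T * T by the Cayley-Dickson doubling construction. *)

From HB Require Import structures.
Require Import Defs.
From mathcomp Require Import all_boot all_order all_fingroup all_algebra all_solvable.
From mathcomp Require Import all_field ring.

Set Implicit Arguments.
Unset Strict Implicit.
Import GRing.Theory.
Local Open Scope ring_scope.

(** * Hensel lifting of square roots, for odd primes and for 2 *)

Lemma odd_prime_sqr_lift (p : nat) (a c : int) (n : nat) :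
  prime p -> odd p -> ~~ (p %| a)%Z -> (p %| a ^+ 2 - c)%Z ->
  exists b : int, ((p : int) ^+ n.+1 %| b ^+ 2 - c)%Z.
Proof.
move=> p_pr p_odd pNa pDa.
(* The induction also keeps [b] prime to [p], so that [2 * b] stays invertible modulo [p]. *)
suff [b [_]] : exists b : int,
    ~~ (p %| b)%Z /\ ((p : int) ^+ n.+1 %| b ^+ 2 - c)%Z by exists b.
elim: n => [|n [b [pNb /dvdzP[q Dq]]]]; first by exists a; rewrite expr1.
have /coprimezP[[u v] /= Duv] : coprimez (2 * b) p.
  rewrite coprimezMl; apply/andP; split.
    by rewrite coprimezE /= coprime2n.
  by rewrite coprimez_sym coprimezE /= prime_coprime.
(* Newton step: [q] is the quotient of [b ^+ 2 - c] by the current power of [p], and [u] inverts the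
   derivative [2 * b] modulo [p]. *)
exists (b - p%:Z ^+ n.+1 * (q * u)); split.
  by rewrite rpredBr // exprS -mulrA dvdz_mulr.
have -> : (b - p%:Z ^+ n.+1 * (q * u)) ^+ 2 - c =
    (q * v + p%:Z ^+ n * (q * u) ^+ 2) * p%:Z ^+ n.+2.
  have -> : (b - p%:Z ^+ n.+1 * (q * u)) ^+ 2 - c =
    (b ^+ 2 - c) - (u * (2 * b)) * q * p%:Z ^+ n.+1
      + (p%:Z ^+ n.+1) ^+ 2 * (q * u) ^+ 2 by ring.
  rewrite Dq; have -> : u * (2 * b) = 1 - v * p by rewrite -[X in X - _]Duv; ring.
  by rewrite !exprS; ring.
exact: dvdz_mull.
Qed.

(** The derivative of a square is even, so the lifting starts from a root modulo 8: since 1 + 7 = 8,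
    the odd number 1 is one. *)
Lemma two_adic_sqrt_neg7 (n : nat) :
  exists a : int, (2 ^+ n %| a ^+ 2 + 7)%Z.
Proof.
suff [b Db] : exists b : int, (2 ^+ n.+3 %| (2 * b + 1) ^+ 2 + 7)%Z.
  exists (2 * b + 1); apply: dvdz_trans Db.
  by rewrite dvdz_exp2l // -addn3 leq_addr.
elim: n => [|n [b /dvdzP[q Dq]]]; first by exists 0.
(* Up to multiples of [2 ^+ n.+4], this adds [2 ^+ n.+3 * q * (2 * b + 1)] to the old value
   [q * 2 ^+ n.+3]; the two add up to an even multiple of [2 ^+ n.+3]. *)
exists (b + 2 ^+ n.+1 * q).
have -> : (2 * (b + 2 ^+ n.+1 * q) + 1) ^+ 2 + 7 =
    (q * (b + 1) + 2 ^+ n * q ^+ 2) * 2 ^+ n.+4.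
  have -> : (2 * (b + 2 ^+ n.+1 * q) + 1) ^+ 2 + 7 =
    ((2 * b + 1) ^+ 2 + 7) + 2 ^+ n.+2 * q * (2 * (2 * b + 1))
      + (2 ^+ n.+2 * q) ^+ 2 by rewrite !exprS; ring.
  by rewrite Dq !exprS; ring.
exact: dvdz_mull.
Qed.

(** * Representing -1 by squares modulo [p] and its powers *)

Section Residues.
Variables (p : nat) (p_pr : prime p).

Lemma dvdz_Fp (a : int) : (p %| a)%Z = (a%:~R == 0 :> 'F_p).
Proof. exact: dvdz_pcharf (pchar_Fp p_pr) a. Qed.

Lemma Fp_intr (x : 'F_p) : exists a : int, a%:~R = x.
Proof. by exists (val x : int); rewrite -pmulrn natr_Zp. Qed.

(** With [p = 4 * k + 1], at most [2 * k] of the [4 * k] nonzero residues are roots of unity of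
    order dividing [2 * k]. For any other [x], the power [x ^+ (2 * k)] squares to 1 by Fermat,
    hence is -1. *)
Lemma Fp_sqrt_neg1 : (p = 1 %[mod 4])%N -> exists x : 'F_p, x ^+ 2 = -1.
Proof.
move=> p1; pose k := (p %/ 4)%N.
have Dp : p = (4 * k + 1)%N by rewrite mulnC {1}(divn_eq p 4) p1.
have k_gt0 : (0 < k)%N by case: k Dp => // Dp; move: p_pr; rewrite Dp.
have card_nz : #|[pred x : 'F_p | x != 0]| = (4 * k)%N.
  rewrite (eq_card (B := predC1 0)) => [|x]; last by rewrite !inE.
  by rewrite cardC1 card_Fp // {1}Dp addn1.
have [all1|/allPn[x]] :=
    boolP (all (2 * k).-unity_root (enum [pred x : 'F_p | x != 0])).
  have := max_unity_roots _ all1 (enum_uniq _).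
  rewrite -cardE card_nz leq_pmul2r // => H.
  by have := H ltac:(by rewrite muln_gt0).
rewrite mem_enum inE unity_rootE => x_nz xN1; exists (x ^+ k).
have : (x ^+ (2 * k)) ^+ 2 == 1.
  rewrite -exprM mulnAC -(inj_eq (mulfI x_nz)) mulr1 -exprS -addn1 -Dp.
  by rewrite -[X in x ^+ X](card_Fp p_pr) expf_card.
by rewrite sqrf_eq1 (negPf xN1) /= -exprM mulnC => /eqP.
Qed.

(** Pigeonhole: the squares and their reflections [c - y] each fill more than half of the field, so
    they meet. *)
Lemma Fp_sum_two_squares (c : 'F_p) : odd p ->
  exists x y : 'F_p, x ^+ 2 + y ^+ 2 = c.
Proof.
move=> p_odd; pose sq := [set x ^+ 2 | x : 'F_p].
have card_sq : (p < 2 * #|sq|)%N.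
  (* Each fibre of squaring lies in a pair [x], [- x]; the inequality becomes strict because [p] is
     odd. *)
  have : (p <= 2 * #|sq|)%N.
    rewrite -{1}(card_Fp p_pr) -(sum1_card 'F_p).
    rewrite (partition_big (fun x => x ^+ 2) (mem sq)) /=; last first.
      by move=> x _; apply: imset_f.
    have -> : (2 * #|sq| = \sum_(y in sq) 2)%N by rewrite sum_nat_const mulnC.
    rewrite leq_sum // => _ /imsetP[x _ ->].
    rewrite sum1_card; apply: (@leq_trans #|[set x; - x]|).
      by apply/subset_leq_card/subsetP => y yx; rewrite !inE -eqf_sqr.
    by rewrite cards2; case: eqP.
  rewrite leq_eqVlt => /orP[/eqP Ep|//].
  by move: p_odd; rewrite {1}Ep mul2n odd_double.
pose sq' := [set c - y | y in sq].
have card_sq' : #|sq'| = #|sq| by apply: card_imset => x y /addrI/oppr_inj.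
have /set0Pn[_ /setIP[/imsetP[x _ ->] /imsetP[_ /imsetP[y _ ->] Dx]]] :
    sq :&: sq' != set0.
  rewrite -card_gt0; have := max_card (mem (sq :|: sq')).
  rewrite card_Fp // cardsU card_sq' addnn -mul2n; apply: contraLR.
  by rewrite -eqn0Ngt => /eqP ->; rewrite subn0 -ltnNge.
by exists x, y; rewrite Dx subrK.
Qed.

Lemma sqr_eq_neg1_modX (n : nat) : (p = 1 %[mod 4])%N ->
  exists a : int, ((p : int) ^+ n %| a ^+ 2 + 1)%Z.
Proof.
move=> p1; have [x Dx] := Fp_sqrt_neg1 p1; have [a Da] := Fp_intr x.
have p_odd : odd p by rewrite (divn_eq p 4) p1 oddD oddM andbF.
have pNa : ~~ (p %| a)%Z.
  rewrite dvdz_Fp Da; apply: contra_eq_neq Dx => ->.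
  by rewrite expr0n eq_sym oppr_eq0 oner_eq0.
have [|b Db] := odd_prime_sqr_lift (c := -1) n p_pr p_odd pNa.
  by rewrite dvdz_Fp opprK rmorphD rmorphXn /= Da Dx addNr.
by exists b; rewrite -(opprK 1); apply: dvdz_trans Db; rewrite exprS dvdz_mull.
Qed.

Lemma sum_two_squares_eq_neg1_modX (n : nat) : odd p ->
  exists a b : int, ((p : int) ^+ n %| a ^+ 2 + b ^+ 2 + 1)%Z.
Proof.
move=> p_odd; have [x [y]] := Fp_sum_two_squares (-1) p_odd.
wlog : x y / x != 0 => [IH|x_nz].
  have [x0|] := eqVneq x 0; last by move/IH; apply.
  have [y0|] := eqVneq y 0; last by move/IH=> H Dxy; apply: (H x); rewrite addrC.
  by rewrite x0 y0 expr0n addr0 => /esym/eqP; rewrite oppr_eq0 oner_eq0.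
have [a Da] := Fp_intr x; have [b Db] := Fp_intr y.
move: x_nz; rewrite -Da -Db => a_nz Dab.
have [||a' Da'] := @odd_prime_sqr_lift p a (- (b ^+ 2) - 1) n p_pr p_odd.
- by rewrite dvdz_Fp.
- by rewrite dvdz_Fp !rmorphB rmorphN !rmorphXn /= opprB opprK addrCA Dab subrr.
exists a', b; apply: dvdz_trans (_ : (p%:Z ^+ n.+1 %| _)%Z).
  by rewrite exprS dvdz_mull.
by move: Da'; rewrite -addrA opprB opprK (addrC 1).
Qed.

End Residues.

(** * Composing isometries and regrouping orthogonal sums *)

Lemma isometric_morph (U V : zmodType) (f : U -> QmodZ) (g : V -> QmodZ)
    (h : U -> V) :
  zmod_morphism h -> bijective h -> (forall x, g (h x) = f x) -> f \cong g.
Proof.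
move=> h_morph h_bij gh.
pose hA := HB.pack_for {additive U -> V} h
  (GRing.isZmodMorphism.Build U V h h_morph).
by exists hA.
Qed.

Lemma isometric_trans (U V W : zmodType) (f : U -> QmodZ) (g : V -> QmodZ)
    (k : W -> QmodZ) : f \cong g -> g \cong k -> f \cong k.
Proof.
move=> [h [h_bij gh]] [h' [h'_bij kh']].
exists (h' \o h); split; first exact: bij_comp.
by move=> x /=; rewrite kh' gh.
Qed.

Section OrthogonalSum.
Variables (U V W : zmodType).
Variables (f : U -> QmodZ) (g : V -> QmodZ) (k : W -> QmodZ).

Lemma orthogonal_sumA : f \perp (g \perp k) \cong f \perp g \perp k.
Proof.
apply: (@isometric_morph _ _ _ _ (fun x => ((x.1, x.2.1), x.2.2))) => //.
  by exists (fun x => (x.1.1, (x.1.2, x.2))) => [[x [y z]]|[[x y] z]].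
by move=> [x [y z]]; rewrite /orthogonal_sum /= addrA.
Qed.

Lemma orthogonal_sumA_sym : f \perp g \perp k \cong f \perp (g \perp k).
Proof.
apply: (@isometric_morph _ _ _ _ (fun x => (x.1.1, (x.1.2, x.2)))) => //.
  by exists (fun x => ((x.1, x.2.1), x.2.2)) => [[[x y] z]|[x [y z]]].
by move=> [[x y] z]; rewrite /orthogonal_sum /= addrA.
Qed.

End OrthogonalSum.

(** * Calculus of the polar form of a quadratic function *)

Definition polar (U : zmodType) (Q : U -> QmodZ) (x y : U) : QmodZ :=
  Q (x + y) - Q x - Q y.

Section Polar.
Variables (U : zmodType) (Q : U -> QmodZ).
Hypothesis Q_quad : quadratic Q.
Local Notation B := (polar Q).

Lemma polarC x y : B x y = B y x.
Proof. by rewrite /polar (addrC y) addrAC. Qed.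

Lemma polarBr x y z : B x (y - z) = B x y - B x z.
Proof. exact: (Q_quad.1.2 x y z). Qed.

Lemma polarBl x y z : B (x - y) z = B x z - B y z.
Proof. exact: (Q_quad.1.1 z x y). Qed.

Lemma polarNr x y : B x (- y) = - B x y.
Proof. by rewrite -sub0r polarBr -{1}(subrr 0) polarBr subrr sub0r. Qed.

Lemma polarNl x y : B (- x) y = - B x y.
Proof. by rewrite polarC polarNr polarC. Qed.

Lemma polarDr x y z : B x (y + z) = B x y + B x z.
Proof. by rewrite -{1}[z]opprK polarBr polarNr opprK. Qed.

Lemma polarDl x y z : B (x + y) z = B x z + B y z.
Proof. by rewrite polarC polarDr !(polarC z). Qed.

Lemma polarMnr x y n : B x (y *+ n) = B x y *+ n.
Proof.
elim: n => [|n IH]; last by rewrite !mulrS polarDr IH.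
by rewrite !mulr0n -(subrr x) polarBr subrr.
Qed.

Lemma polarMzr x y (a : int) : B x (y *~ a) = B x y *~ a.
Proof. by case: a => n; rewrite ?NegzE ?mulrNz ?polarNr polarMnr. Qed.

Lemma polarMzl x y (a : int) : B (x *~ a) y = B x y *~ a.
Proof. by rewrite polarC polarMzr polarC. Qed.

Lemma quadraticN x : Q (- x) = Q x.
Proof. by have := Q_quad.2 (-1) x; rewrite sqrrN expr1n mulrN1z. Qed.

Lemma quadratic0 : Q 0 = 0.
Proof. by have := Q_quad.2 0 0; rewrite !mulr0z. Qed.

Lemma quadraticD x y : Q (x + y) = Q x + Q y + B x y.
Proof. by rewrite /polar -[X in _ = _ + X]addrA -opprD addrCA subrr addr0. Qed.

Lemma quadraticB x y : Q (x - y) = Q x + Q y - B x y.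
Proof. by rewrite quadraticD quadraticN polarNr. Qed.

End Polar.

(** * Cayley-Dickson doubling of similitudes *)

Section Doubling.
Variables (U : zmodType) (Q : U -> QmodZ) (f f' g g' : U -> U) (m n : int).

(** The block matrix with rows [(f, g)] and [(- g', f')]: the complex 2-by-2 matrix of a quaternion
    when the primes denote conjugation. *)
Definition double_map (x : (U * U)%type) : (U * U)%type :=
  (f x.1 + g x.2, f' x.2 - g' x.1).

Lemma double_map_morph :
    zmod_morphism f -> zmod_morphism f' -> zmod_morphism g -> zmod_morphism g' ->
  zmod_morphism double_map.
Proof.
move=> fB f'B gB g'B [x1 x2] [y1 y2]; rewrite /double_map /= fB f'B gB g'B.
by congr (_, _); rewrite /= !opprD addrACA.
Qed.

(** The last hypothesis makes the cross terms of the two coordinates cancel. *)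
Lemma double_map_similitude : quadratic Q ->
    (forall x, Q (f x) = Q x *~ m) -> (forall x, Q (f' x) = Q x *~ m) ->
    (forall x, Q (g x) = Q x *~ n) -> (forall x, Q (g' x) = Q x *~ n) ->
    (forall x y, polar Q (f x) (g y) = polar Q (g' x) (f' y)) ->
  forall x, (Q \perp Q) (double_map x) = (Q \perp Q) x *~ (m + n).
Proof.
move=> Qq Qf Qf' Qg Qg' adj [x y]; rewrite /orthogonal_sum /double_map /=.
rewrite (quadraticD Q) (quadraticB Qq) Qf Qf' Qg Qg' adj (polarC _ (f' y)).
rewrite addrACA subrr addr0 !mulrzDl !mulrzDr (addrC (Q y *~ m) (Q x *~ n)).
by rewrite [LHS]addrACA (addrC (Q y *~ n)).
Qed.

End Doubling.

(** The matrix with rows [(f', - g)] and [(g', f)] times that of [double_map] is the scalar [m + n],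
    which acts as -1; its opposite is thus a left inverse. *)
Lemma double_map_inj (U : zmodType) (f f' g g' : {additive U -> U}) (m n : int) :
    (forall x, f' (f x) = x *~ m) -> (forall x, f (f' x) = x *~ m) ->
    (forall x, g (g' x) = x *~ n) -> (forall x, g' (g x) = x *~ n) ->
    (forall x, f' (g x) = g (f' x)) -> (forall x, g' (f x) = f (g' x)) ->
    (forall x : U, x *~ (m + n) = - x) ->
  injective (double_map f f' g g').
Proof.
move=> f'f ff' gg' g'g f'g g'f mnN.
apply: (@can_inj _ _ _ (fun y => (- (f' y.1 - g y.2), - (g' y.1 + f y.2)))).
move=> [x y]; rewrite /double_map /= (raddfD f') (raddfB g) (raddfD g') (raddfB f).
rewrite f'f ff' gg' g'g f'g g'f.
congr (_, _); apply: oppr_inj; rewrite opprK -[RHS]mnN mulrzDr.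
  by rewrite opprB addrACA subrr addr0.
by rewrite [LHS](AC (2*2) ((1*4)*(3*2))) /= subrr add0r.
Qed.

Section OrthogonalSumQuadratic.
Variables (U V : zmodType) (f : U -> QmodZ) (g : V -> QmodZ).

Lemma polar_orthogonal_sum x y :
  polar (f \perp g) x y = polar f x.1 y.1 + polar g x.2 y.2.
Proof.
rewrite /polar /orthogonal_sum /= !opprD.
by rewrite [LHS](AC ((2*2)*2) ((1*3*5)*(2*4*6))).
Qed.

Lemma quadratic_orthogonal_sum :
  quadratic f -> quadratic g -> quadratic (f \perp g).
Proof.
move=> fq gq; split; last first.
  move=> a x; rewrite /orthogonal_sum.
  by rewrite (raddfMz fst) (raddfMz snd) /= fq.2 gq.2 mulrzDl.
split=> [z x y|z x y]; rewrite -!/(polar _ _ _) !polar_orthogonal_sum /=.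
  by rewrite (polarBl fq) (polarBl gq) [in RHS]opprD [LHS]addrACA.
by rewrite (polarBr fq) (polarBr gq) [in RHS]opprD [LHS]addrACA.
Qed.

End OrthogonalSumQuadratic.

(** * Action of the Gaussian integers on [T * T] *)

Section ComplexMultiplication.
Variables (T : zmodType).

(* Multiplication by a + bi on T (x) Z[i], identified with T * T. *)
Definition cmul (a b : int) (x : (T * T)%type) : (T * T)%type :=
  (x.1 *~ a - x.2 *~ b, x.2 *~ a + x.1 *~ b).

Lemma cmul_morph a b : zmod_morphism (cmul a b).
Proof.
move=> [x1 x2] [y1 y2]; rewrite /cmul /= !mulrzBl.
by congr (_, _); rewrite /= !opprD ?opprK addrACA.
Qed.

HB.instance Definition _ a b :=
  GRing.isZmodMorphism.Build (T * T)%type (T * T)%type (cmul a b) (cmul_morph a b).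

Lemma cmul_cmul a b c d x :
  cmul a b (cmul c d x) = cmul (a * c - b * d) (a * d + b * c) x.
Proof.
case: x => x y; rewrite /cmul /= !mulrzBr !mulrzDr !mulrzBl !mulrzDl -!mulrzA.
rewrite !(mulrC _ a) !(mulrC _ b) !opprD.
by congr (_, _); rewrite [LHS](AC (2*2) ((1*4)*(2*3))).
Qed.

Lemma cmul_int (m : int) x : cmul m 0 x = x *~ m.
Proof.
case: x => x y; rewrite /cmul /= !mulr0z subr0 addr0.
by apply: injective_projections; rewrite (raddfMz fst, raddfMz snd).
Qed.

Lemma cmul_conj a b x : cmul a (- b) (cmul a b x) = x *~ (a ^+ 2 + b ^+ 2).
Proof. by rewrite cmul_cmul -cmul_int; congr (cmul _ _ _); ring. Qed.

Lemma cmul_comm a b c d x : cmul a b (cmul c d x) = cmul c d (cmul a b x).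
Proof. by rewrite !cmul_cmul; congr (cmul _ _ _); ring. Qed.

Variables (psi : T -> QmodZ).
Hypothesis psi_quad : quadratic psi.

(** [cmul a b] is itself a doubling, of the scalar multiplications by [a] and by [- b]. *)
Lemma cmul_similitude a b x :
  (psi \perp psi) (cmul a b x) = (psi \perp psi) x *~ (a ^+ 2 + b ^+ 2).
Proof.
rewrite -[b in RHS]opprK sqrrN; pose s (c : int) (y : T) := y *~ c.
rewrite -(@double_map_similitude _ psi (s a) (s a) (s (- b)) (s (- b))) //.
- by rewrite /double_map /s /cmul /= !mulrNz opprK.
- by move=> y; rewrite psi_quad.2.
- by move=> y; rewrite psi_quad.2.
- by move=> y; rewrite psi_quad.2.
- by move=> y; rewrite psi_quad.2.
by move=> y z; rewrite /s !(polarMzl psi_quad) !(polarMzr psi_quad) mulrzAC.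
Qed.

(** Conjugate Gaussian integers act as adjoints for the polar form and all these actions commute, so
    both factors can change sides. This is the cancellation condition of [double_map_similitude]. *)
Lemma polar_cmul a b c d x y :
  polar (psi \perp psi) (cmul a b x) (cmul c d y) =
  polar (psi \perp psi) (cmul c (- d) x) (cmul a (- b) y).
Proof.
case: x y => [x1 x2] [y1 y2]; rewrite !polar_orthogonal_sum /cmul /=.
rewrite !mulrNz !opprK.
rewrite !(polarDl psi_quad, polarDr psi_quad).
rewrite !(polarNl psi_quad, polarNr psi_quad) !opprK.
rewrite !(polarMzl psi_quad, polarMzr psi_quad) -!mulrzA.
rewrite !(mulrC _ a) !(mulrC _ b).
by rewrite [LHS](AC ((2*2)*(2*2)) ((1*7)*(6*4)*((5*3)*(2*8)))).
Qed.

End ComplexMultiplication.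

(** * Isometries from integers congruent to -1 modulo the squared order of [T] *)

Lemma mulrz_card (T : finZmodType) (x : T) : x *~ #|T| = 0.
Proof. by rewrite -pmulrn -FinRing.zmodXgE -cardsT expg_cardG ?inE. Qed.

Section NegativeUnits.
Variables (T : finZmodType) (psi : T -> QmodZ) (m : int).
Hypotheses (psi_quad : quadratic psi) (m_neg1 : ((#|T| : int) ^+ 2 %| m + 1)%Z).

Lemma mulrz_neg1 (x : T) : x *~ m = - x.
Proof.
have /dvdzP[q Dm] := m_neg1; rewrite -[m](addrK 1) Dm expr2 mulrzBr mulr1z.
by rewrite mulrA mulrC mulrzA mulrz_card mul0rz sub0r.
Qed.

(** [psi x] times the square of [#|T|] is [psi] of [x *~ #|T|], that is [psi 0]; hence the square in
    the modulus. *)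
Lemma mulrz_neg1_quadratic x : psi x *~ m = - psi x.
Proof.
have /dvdzP[q Dm] := m_neg1; rewrite -[m](addrK 1) Dm mulrzBr mulr1z.
by rewrite mulrC mulrzA -psi_quad.2 mulrz_card quadratic0 // mul0rz sub0r.
Qed.

End NegativeUnits.

Section Isometries.
Variables (T : finZmodType) (psi : T -> QmodZ).
Hypothesis psi_quad : quadratic psi.
Local Notation N2 := ((#|T| : int) ^+ 2).

Lemma isometric_opp1 (a : int) : (N2 %| a ^+ 2 + 1)%Z -> psi \cong (\- psi).
Proof.
move=> aN; apply: (@isometric_morph _ _ _ _ (fun x => x *~ a)).
- by move=> x y; rewrite mulrzBl.
(* On a finite group a left inverse suffices; [- a] inverts [a] because [a ^+ 2] acts as -1. *)
- apply: injF_bij; apply: (@can_inj _ _ _ (fun x => - (x *~ a))) => x.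
  by rewrite -mulrzA (mulrz_neg1 aN) opprK.
by move=> x; rewrite /= psi_quad.2 (mulrz_neg1_quadratic psi_quad aN) opprK.
Qed.

Lemma isometric_opp2 (a b : int) : (N2 %| a ^+ 2 + b ^+ 2 + 1)%Z ->
  psi \perp psi \cong (\- psi) \perp (\- psi).
Proof.
move=> abN; apply: (@isometric_morph _ _ _ _ (cmul a b)).
- exact: cmul_morph.
- apply: injF_bij; apply: (@can_inj _ _ _ (fun x => - cmul a (- b) x)) => x.
  rewrite cmul_conj; apply: injective_projections => /=;
    by rewrite (raddfMz fst, raddfMz snd) /= (mulrz_neg1 abN) opprK.
move=> x; have := cmul_similitude psi_quad a b x.
rewrite mulrzDl !(mulrz_neg1_quadratic psi_quad abN) -!opprD.
by rewrite /orthogonal_sum /= -!opprD => ->; rewrite opprK.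
Qed.

(** The quaternion is the doubling of the Gaussian integers [a + bi] and [c + di], so the four
    summands are first regrouped into two pairs. *)
Lemma isometric_opp4 (a b c d : int) :
    (N2 %| a ^+ 2 + b ^+ 2 + (c ^+ 2 + d ^+ 2) + 1)%Z ->
  psi \perp psi \perp psi \perp psi
    \cong (\- psi) \perp (\- psi) \perp (\- psi) \perp (\- psi).
Proof.
move=> abcdN; apply: isometric_trans (orthogonal_sumA_sym _ _ _) _.
apply: isometric_trans (orthogonal_sumA _ _ _).
pose h := double_map (@cmul T a b) (cmul a (- b)) (cmul c d) (cmul c (- d)).
apply: (@isometric_morph _ _ _ _ h).
- by apply: double_map_morph; apply: cmul_morph.
- apply: injF_bij.
  apply: (@double_map_inj _ _ _ _ _ (a ^+ 2 + b ^+ 2) (c ^+ 2 + d ^+ 2)) => x /=.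
  + exact: cmul_conj.
  + by rewrite cmul_comm cmul_conj.
  + by rewrite cmul_comm cmul_conj.
  + exact: cmul_conj.
  + exact: cmul_comm.
  + exact: cmul_comm.
  by apply: injective_projections => /=;
    rewrite (raddfMz fst, raddfMz snd) /= (mulrz_neg1 abcdN).
move=> x; have qq := quadratic_orthogonal_sum psi_quad psi_quad.
have := @double_map_similitude _ _ (@cmul T a b) (cmul a (- b)) (cmul c d)
  (cmul c (- d)) (a ^+ 2 + b ^+ 2) (c ^+ 2 + d ^+ 2) qq.
move/(_ (cmul_similitude psi_quad a b)).
move/(_ (fun x => etrans (cmul_similitude psi_quad a (- b) x) ltac:(by rewrite sqrrN))).
move/(_ (cmul_similitude psi_quad c d)).
move/(_ (fun x => etrans (cmul_similitude psi_quad c (- d) x) ltac:(by rewrite sqrrN))).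
move/(_ (polar_cmul psi_quad a b c d) x).
rewrite [in RHS]/orthogonal_sum !mulrzDl !(mulrz_neg1_quadratic psi_quad abcdN).
by rewrite -/h /orthogonal_sum /= -!opprD => ->; rewrite opprK.
Qed.

End Isometries.

Theorem theorem1p16 (p : nat) (p_prime : prime p) (T : finZmodType)
    (T_pgroup : (p.-group [set: T])%g) (psi : T -> QmodZ)
    (psi_quadratic : quadratic psi) :
  [/\ (p = 1 %[mod 4])%N -> psi \cong (\- psi),
      (p = 3 %[mod 4])%N -> psi \perp psi \cong (\- psi) \perp (\- psi)
    & (p = 2)%N ->
      psi \perp psi \perp psi \perp psi
      \cong (\- psi) \perp (\- psi) \perp (\- psi) \perp (\- psi)].
Proof.
have [k card_T] : exists k, (#|T| : int) ^+ 2 = (p : int) ^+ k.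
  have /p_natP[k Dk] := T_pgroup; exists (k * 2)%N.
  by rewrite exprM -cardsT Dk -natz -[in RHS]natz natrX.
split=> [p1|p3|p2].
- have [a Da] := sqr_eq_neg1_modX p_prime k p1.
  by apply: (isometric_opp1 psi_quadratic (a := a)); rewrite card_T.
- have p_odd : odd p by rewrite (divn_eq p 4) p3 oddD oddM andbF.
  have [a [b Dab]] := sum_two_squares_eq_neg1_modX p_prime k p_odd.
  by apply: (isometric_opp2 psi_quadratic (a := a) (b := b)); rewrite card_T.
have [a Da] := two_adic_sqrt_neg7 k.
apply: (isometric_opp4 psi_quadratic (a := a) (b := 2) (c := 1) (d := 1)).
(* -1 = a^2 + 2^2 + 1^2 + 1^2 with a^2 = -7. *)
rewrite card_T p2; apply: etrans Da; congr (_ %| _)%Z; ring.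
Qed.
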